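(* For every positive integer $k$, the polynomial removal threshold of the odd cycle $C_{2k+1}$ satisfies $\delta_{\mathrm{poly\text{-}rem}}(C_{2k+1})\geq \frac{1}{2k+1}$.
   Context: For a graph $H$ on $h$ vertices and $\gamma \in [0,1]$, $\delta(\varepsilon,H;\gamma)$ denotes the maximum $\delta\in[0,1]$ such that every $n$-vertex graph with minimum degree at least $\gamma n$ and fewer than $\delta n^h$ copies of $H$ can be made $H$-free by deleting at most $\varepsilon n^2$ edges. The polynomial removal threshold of $H$ is $\delta_{\mathrm{poly\text{-}rem}}(H)=\inf\{\gamma\in[0,1]: \exists \mu>0 \text{ with } \delta(\varepsilon,H;\gamma)\ge \mu\varepsilon^{1/\mu} \text{ for all } \varepsilon\in(0,1)\}$. *)

(* Defs.v *)
From mathcomp Require Import all_boot all_order all_algebra.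
From mathcomp Require Import all_classical all_reals all_analysis.
Set Implicit Arguments.
Unset Strict Implicit.
Unset Printing Implicit Defensive.
Import Order.TTheory GRing.Theory Num.Theory.
Local Open Scope ring_scope.

Record sgraph (V : finType) := SGraph {
  adj :> rel V;
  adj_sym : symmetric adj;
  adj_irrefl : irreflexive adj }.

Section Graphs.
Local Open Scope nat_scope.

Definition edges (V : finType) (G : sgraph V) : {set {set V}} :=
  [set [set p.1; p.2]%SET | p : V * V & G p.1 p.2].

Definition degree (V : finType) (G : sgraph V) (v : V) : nat := #|[set u | G v u]|.

Lemma del_sym (V : finType) (G : sgraph V) (D : {set {set V}}) :
  symmetric (fun u v => G u v && ([set u; v]%SET \notin D)).
Proof. by move=> u v; rewrite adj_sym finset.setUC. Qed.

Lemma del_irrefl (V : finType) (G : sgraph V) (D : {set {set V}}) :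
  irreflexive (fun u v => G u v && ([set u; v]%SET \notin D)).
Proof. by move=> u; rewrite adj_irrefl. Qed.

Definition del_edges (V : finType) (G : sgraph V) (D : {set {set V}}) : sgraph V :=
  SGraph (del_sym G D) (del_irrefl G D).

Definition embedding (T V : finType) (H : sgraph T) (G : sgraph V)
    (f : {ffun T -> V}) : bool :=
  injectiveb f && [forall x, forall y, H x y ==> G (f x) (f y)].

(* A copy of H in G is a (not necessarily induced) subgraph of G isomorphic to
   H, given by its vertex set and its edge set; so copies are unlabelled, each
   one arising from #|Aut H| embeddings. *)
Definition copies (T V : finType) (H : sgraph T) (G : sgraph V) :
    {set {set V} * {set {set V}}} :=
  [set (f @: [set: T], [set f @: (e : {set T}) | e in edges H])%SET
     | f : {ffun T -> V} & embedding H G f].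

Definition is_free (T V : finType) (H : sgraph T) (G : sgraph V) : Prop :=
  copies H G = finset.set0.

Definition cycle_adj (n : nat) : rel 'I_n := fun i j =>
  (i != j) && ((i.+1 %% n == j) || (j.+1 %% n == i)).

Lemma cycle_sym n : symmetric (@cycle_adj n).
Proof. by move=> i j; rewrite /cycle_adj eq_sym orbC. Qed.

Lemma cycle_irrefl n : irreflexive (@cycle_adj n).
Proof. by move=> i; rewrite /cycle_adj eqxx. Qed.

(* this is the cycle C_n when n >= 3 *)
Definition cycle_graph (n : nat) : sgraph 'I_n :=
  SGraph (@cycle_sym n) (@cycle_irrefl n).

End Graphs.

Section Threshold.
Variables (R : realType) (T : finType) (H : sgraph T).
Implicit Types eps gamma d mu : R.

Definition removable eps (V : finType) (G : sgraph V) : Prop :=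
  exists D : {set {set V}}, [/\ D \subset edges G,
    #|D|%:R <= eps * #|V|%:R ^+ 2 & is_free H (del_edges G D)].

Definition removal_prop eps gamma d : Prop :=
  forall (V : finType) (G : sgraph V),
    (forall v, gamma * #|V|%:R <= (degree G v)%:R) ->
    #|copies H G|%:R < d * #|V|%:R ^+ #|T| ->
    removable eps G.

Definition removal_set eps gamma : set R :=
  [set d | 0 <= d <= 1 /\ removal_prop eps gamma d]%classic.

(* delta(eps, H; gamma); the supremum is a maximum by removal_delta_max *)
Definition removal_delta eps gamma : R := sup (removal_set eps gamma).

Lemma removal_delta_max eps gamma :
  removal_set eps gamma (removal_delta eps gamma).
Proof.
have S0 : removal_set eps gamma 0.
  split; first by rewrite lexx ler01.
  by move=> V G _; rewrite mul0r ltrn0.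
have hS : has_sup (removal_set eps gamma).
  by split; [exists 0 | exists 1 => d [/andP[]]].
split.
  apply/andP; split; first exact: (sup_upper_bound hS).
  by apply: ge_sup; [exists 0 | move=> d [/andP[]]].
move=> V G degG ltc.
have [V0|V0] := posnP (#|V| ^ #|T|)%N.
  by move: ltc; rewrite -natrX V0 mulr0 ltrn0.
have P0 : 0 < #|V|%:R ^+ #|T| :> R by rewrite -natrX ltr0n.
have e0 : 0 < removal_delta eps gamma - #|copies H G|%:R / #|V|%:R ^+ #|T|.
  by rewrite subr_gt0 ltr_pdivrMr.
have [d [_ Pd]] := sup_adherent e0 hS.
by rewrite subKr ltr_pdivrMr // => /(Pd V G degG).
Qed.

Definition poly_rem_set : set R :=
  [set gamma | 0 <= gamma <= 1 /\ exists2 mu, 0 < mu &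
     forall eps, 0 < eps < 1 -> mu * eps `^ mu^-1 <= removal_delta eps gamma]%classic.

(* `inf` is a true infimum here, by has_inf_poly_rem_set *)
Definition delta_poly_rem : R := inf poly_rem_set.

Lemma has_inf_poly_rem_set : (0 < #|T|)%N -> has_inf poly_rem_set.
Proof.
move=> T0; split; last by exists 0 => g [/andP[]].
exists 1; split; first by rewrite lexx ler01.
exists 1 => // eps /andP[e0 e1].
rewrite mul1r invr1 powRr1; last exact: ltW.
apply: (le_trans (ltW e1)).
apply: ub_le_sup; first by exists 1 => d [/andP[]].
split; first by rewrite lexx ler01.
move=> V G degG; rewrite mul1r -natrX ltr_nat.
case: (posnP #|V|) => [->|]; first by rewrite exp0n.
move=> /card_gt0P[v _]; have := degG v; rewrite mul1r ler_nat.
rewrite leqNgt => /negP[]; rewrite /degree -cardsT; apply: proper_card.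
apply/properP; split; first exact: finset.subsetT.
by exists v; rewrite ?finset.in_setT // finset.inE adj_irrefl.
Qed.

End Threshold.

(* Main.v *)
(** Add to a Ruzsa-Szemeredi graph, an edge-disjoint union of copies of C_q with
    very few further copies of C_q (q = 2k+1, parts V_1, ..., V_q), the blow-up
    A_1, ..., A_q of a path, and join A_i completely to V_i.  If the A_i make up
    almost all the vertices, the minimum degree is close to n/q.  The graph maps
    to the prism over C_q with one edge removed, and a closed walk of odd length
    q in it must go once around the cycle without using rungs; the missing edge
    then confines it to the V_i, so no new copy of C_q appears.  The
    Ruzsa-Szemeredi graph comes from a set S without nontrivial solutions of
    x_1 + ... + x_2k = 2k y; taking for S the points of a sphere in a cube of
    fixed large dimension gives density |G|^(-eta) for any eta > 0, which already
    defeats every polynomial bound. *)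
Require Import Defs.
From mathcomp Require Import all_boot all_order all_algebra.
From mathcomp Require Import all_classical all_reals all_analysis.
From mathcomp Require Import zify ring lra.
Import Order.TTheory GRing.Theory Num.Theory.
Local Open Scope ring_scope.

(** * Dense sets without nontrivial solutions of the mean equation *)

Definition solution_free {G : finZmodType} (h : nat) (S : {set G}) : Prop :=
  forall (x : 'I_h -> G) (s : G), (forall i, x i \in S) -> s \in S ->
  \sum_i x i = s *+ h -> forall i, x i = s.

(* Points of a sphere are in convex position: if y is the mean of the x i,
   then the sum of the |x i - y|^2 is h r - 2 h r + h r = 0. *)
Lemma sphere_mean {h d r : nat} (x : 'I_h -> 'I_d -> nat) (y : 'I_d -> nat) :
    (forall i, (\sum_j x i j ^ 2 = r)%N) -> (\sum_j y j ^ 2 = r)%N ->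
    (forall j, (\sum_i x i j = h * y j)%N) ->
  forall i j, x i j = y j.
Proof.
move=> xr yr mean.
have xrZ i : \sum_j (x i j)%:Z ^+ 2 = r%:Z.
  by rewrite -(xr i) (big_morph Posz PoszD erefl).
have yrZ : \sum_j (y j)%:Z ^+ 2 = r%:Z.
  by rewrite -yr (big_morph Posz PoszD erefl).
have meanZ j : \sum_i (x i j)%:Z = h%:Z * (y j)%:Z.
  by rewrite -PoszM -mean (big_morph Posz PoszD erefl).
have sum0 : \sum_i \sum_j ((x i j)%:Z - (y j)%:Z) ^+ 2 = 0.
  under eq_bigr => i _.
    under eq_bigr => j _ do rewrite sqrrB.
    rewrite big_split /= sumrB xrZ yrZ.
    over.
  rewrite big_split sumrB /= !sumr_const card_ord.
  under eq_bigr => i _ do rewrite sumrMnl.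
  rewrite sumrMnl exchange_big /=.
  under eq_bigr => j _ do rewrite -mulr_suml meanZ -mulrA -expr2.
  rewrite -mulr_sumr yrZ.
  have -> : r%:Z *+ h = h%:Z * r%:Z by rewrite -mulr_natl natz.
  by ring.
move=> i j; apply/eqP; rewrite -eqz_nat -subr_eq0 -sqrf_eq0.
have ge0 i' : 0 <= \sum_j ((x i' j)%:Z - (y j)%:Z) ^+ 2.
  by apply: sumr_ge0 => j' _; apply: sqr_ge0.
move/psumr_eq0P: sum0 => /(_ (fun i _ => ge0 i)) /(_ i isT) /psumr_eq0P.
by move=> /(_ (fun j _ => sqr_ge0 _)) /(_ j isT) ->.
Qed.

Lemma leq_sum_const {I : finType} (F : I -> nat) (c : nat) :
  (forall i, F i <= c)%N -> (\sum_i F i <= #|I| * c)%N.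
Proof.
move=> Fc; rewrite -sum_nat_const.
by under [X in (_ <= X)%N]eq_bigl do rewrite inE; apply: leq_sum => i _.
Qed.

Lemma pigeonhole_fiber {T I : finType} (f : T -> I) : (0 < #|T|)%N ->
  exists i, (#|T| <= #|I| * #|[set x | f x == i]%SET|)%N.
Proof.
move=> /card_gt0P[x0 _].
pose F i := #|[set x | f x == i]%SET|.
have [i _ maxF] := @arg_maxnP _ (f x0) xpredT F isT.
exists i; rewrite -[X in (X <= _)%N]sum1_card (partition_big f xpredT) //=.
apply: leq_sum_const => j.
by rewrite sum1_card -cardsE; apply: maxF.
Qed.

(** Digit vectors on a single sphere are solution-free by [sphere_mean]. Squared norms take at most
    [d D^2 + 1] values, so some sphere holds at least that share of the [D^d] vectors. *)
Lemma dense_solution_free (h D d : nat) : (0 < h)%N -> (0 < D)%N -> (0 < d)%N ->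
  exists (G : finZmodType) (S : {set G}), [/\ solution_free h S, (0 < #|S|)%N,
    (#|G| <= (3 * h) ^ d * d.+1 * D ^ 2 * #|S|)%N & (D ^ d <= #|G|)%N].
Proof.
move=> h0; case: D => // D _ d0.
pose X := {ffun 'I_d -> 'I_D.+1}.
pose Q (x : X) : 'I_(d * D.+1 ^ 2).+1 := inord (\sum_j x j ^ 2).
have QE (x : X) : Q x = (\sum_j x j ^ 2)%N :> nat.
  rewrite inordK // ltnS -[X in (_ <= X * _)%N]card_ord.
  by apply: leq_sum_const => j; rewrite leq_exp2r // ltnW.
(* A sum of [h] digits is at most [N], so equations in ['I_N.+2] lift to the naturals without
   wrap-around. *)
pose N := (h * D.+1)%N.
pose e (x : X) : 'rV['I_N.+2]_d := \row_j (x j : nat)%:R.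
have natI (a b : nat) : (a < N.+2)%N -> (b < N.+2)%N ->
    a%:R = b%:R :> 'I_N.+2 -> a = b.
  move=> aN bN /(congr1 val) /=.
  by rewrite !(@val_Zp_nat N.+2) // !modn_small.
have DN : (D.+1 <= N)%N by rewrite leq_pmull.
have e_inj : injective e.
  move=> x y /rowP exy; apply/ffunP => j; apply/val_inj.
  move: (exy j); rewrite !mxE; apply: natI;
    exact: leq_trans (ltn_ord _) (leqW (leqW DN)).
have [|r hr] := pigeonhole_fiber Q.
  by rewrite card_ffun !card_ord expn_gt0.
pose S : {set 'rV['I_N.+2]_d} := (e @: [set x | Q x == r])%SET.
have cardS : #|S| = #|[set x | Q x == r]%SET| by rewrite card_imset.
rewrite -cardS card_ffun !card_ord in hr.
exists 'rV['I_N.+2]_d, S; split.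
- move=> x s xS sS xs.
  have /choice[x' x'P] i : exists x' : X, Q x' = r /\ x i = e x'.
    by have /imsetP[x' + ->] := xS i; rewrite finset.inE => /eqP ?; exists x'.
  have /imsetP[y + sE] := sS; rewrite finset.inE => /eqP yr.
  have mean j : (\sum_i x' i j = h * y j)%N.
    apply: natI.
    + rewrite ltnS; apply: leqW; rewrite /N -[X in (_ <= X * _)%N]card_ord.
      by apply: leq_sum_const => i; apply: ltnW.
    + by rewrite ltnS; apply: leqW; rewrite leq_mul2l orbC ltnW.
    + move/rowP: xs => /(_ j); rewrite sE mulmxnE mxE summxE natrM mulr_natl.
      rewrite natr_sum => <-; apply: eq_bigr => i _.
      by rewrite (proj2 (x'P i)) mxE.
  have eqxy := @sphere_mean h d r (fun i j => x' i j) (fun j => y j) _ _ mean.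
  move=> i; rewrite (proj2 (x'P i)) sE; congr e.
  apply/ffunP => j; apply/val_inj; apply: eqxy; last by rewrite -QE yr.
  by move=> i'; rewrite -QE (proj1 (x'P i')).
- by case: (#|S|) hr => //; rewrite muln0 leqn0 expn_eq0.
- rewrite card_mx card_ord mul1n.
  have N2 : (N.+2 <= 3 * h * D.+1)%N by rewrite /N; nia.
  apply: (leq_trans (n := ((3 * h * D.+1) ^ d)%N)); first by rewrite leq_exp2r //.
  have -> : ((3 * h) ^ d * d.+1 * D.+1 ^ 2 * #|S| =
             (3 * h) ^ d * (d.+1 * D.+1 ^ 2 * #|S|))%N by rewrite -!mulnA.
  rewrite expnMn leq_mul2l (leq_trans hr) ?orbT // leq_mul2r.
  by rewrite mulSn -[X in (X < _)%N]add0n ltn_add2r expn_gt0 orbT.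
- rewrite card_mx card_ord mul1n.
  by rewrite leq_exp2r // leqW // leqW.
Qed.

(** * Index arithmetic modulo [p.+3] and closed walks of odd length *)

Lemma val_ordD1 {p : nat} (i : 'I_p.+3) : (i + 1 : 'I_p.+3) = (i.+1 %% p.+3)%N :> nat.
Proof. by rewrite /= modnDmr addn1. Qed.

Lemma ordD1_val {p : nat} (i : 'I_p.+3) : i != ord_max -> (i + 1 : 'I_p.+3) = i.+1 :> nat.
Proof.
move=> im; rewrite val_ordD1 modn_small // ltnS ltn_neqAle -ltnS ltn_ord andbT.
by apply: contra im => /eqP im; apply/eqP/val_inj.
Qed.

Lemma ordD1_neq {p : nat} (i : 'I_p.+3) : (i + 1 == i) = false.
Proof. by rewrite -subr_eq0 addrAC subrr add0r oner_eq0. Qed.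

Lemma ordD2_neq {p : nat} (i : 'I_p.+3) : (i + 1 + 1 == i) = false.
Proof.
apply/negbTE; rewrite -subr_eq0 -[i + 1 + 1]addrA addrAC subrr add0r.
by apply/eqP => /(congr1 val); rewrite /= modn_small.
Qed.

Lemma ord_max_D1 {p : nat} : (ord_max : 'I_p.+3) + 1 = 0.
Proof.
by apply: ord_inj; rewrite val_ordD1 modnn.
Qed.

Lemma cycle_adjE {p : nat} (i j : 'I_p.+3) :
  cycle_adj i j = (j == i + 1) || (i == j + 1).
Proof.
have e (a b : 'I_p.+3) : (a.+1 %% p.+3 == b)%N = (b == a + 1).
  by rewrite -val_ordD1 eq_sym.
rewrite /cycle_adj !e; case: eqP => //= ->.
by rewrite orbb eq_sym ordD1_neq.
Qed.

Lemma intr_ord_eq0 {p : nat} (a : int) :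
  a%:~R = 0 :> 'I_p.+3 -> (p.+3 %| `|a|)%N.
Proof.
have natr0 (n : nat) : n%:R = 0 :> 'I_p.+3 -> (p.+3 %| n)%N.
  by move=> /(congr1 val); rewrite /= (@val_Zp_nat p.+3) //; move/eqP.
case: a => n; first exact: natr0.
by rewrite NegzE mulrNz => /eqP; rewrite oppr_eq0 => /eqP; apply: natr0.
Qed.

Lemma ordD1_const {p : nat} (T : Type) (f : 'I_p.+3 -> T) :
  (forall t, f (t + 1) = f t) -> forall t, f t = f 0.
Proof.
move=> fD1 t; rewrite -[t]natr_Zp; elim: (t : nat) => [//|n IHn].
by rewrite mulrSr fD1.
Qed.

(* The steps +1, -1, 0 add up to a multiple of the length of the walk; that
   multiple is odd, as the number of steps 0, which are those that flip c, is
   even.  So the sum is the length or its opposite. *)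
Lemma odd_walk_monotone {p : nat} (i : 'I_p.+3 -> 'I_p.+3) (c : 'I_p.+3 -> bool) :
    odd p.+3 ->
    (forall t, (i (t + 1) = i t + 1 \/ i t = i (t + 1) + 1) /\ c (t + 1) = c t \/
      i (t + 1) = i t /\ c (t + 1) = ~~ c t) ->
  (forall t, i (t + 1) = i t + 1) \/ (forall t, i t = i (t + 1) + 1).
Proof.
move=> oddp step.
(* [em.1] is the signed step; [em.2] witnesses that the step plus the two flags is odd. *)
have /choice[em emP] t : exists em : int * int,
    [/\ i (t + 1) - i t = em.1%:~R, `|em.1| <= 1 &
        em.1 + (c t)%:Z + (c (t + 1))%:Z = 1 + em.2 * 2].
  case: (step t) => [[[->|->] ->]|[-> ->]].
  - exists (1, (c t)%:Z); split=> //=; first by rewrite addrAC subrr add0r.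
    by rewrite -addrA; congr (_ + _); lia.
  - exists (-1, (c t)%:Z - 1); split=> //=; last by lia.
    by rewrite opprD addrA subrr add0r.
  - by exists (0, 0); split=> //=; [rewrite subrr | case: (c t)].
have shift (V : nmodType) (F : 'I_p.+3 -> V) : \sum_t F (t + 1) = \sum_t F t.
  by rewrite [RHS](reindex_inj (addIr 1)).
pose E : int := \sum_t (em t).1.
have dvdE : (p.+3 %| `|E|)%N.
  apply: intr_ord_eq0; rewrite /E rmorph_sum /=.
  under eq_bigr => t _ do have [<- _ _] := emP t.
  by rewrite sumrB shift subrr.
pose C : int := \sum_t (c t)%:Z; pose M : int := \sum_t (em t).2.
have EE : E + C + C = p.+3%:Z + M * 2.
  have : \sum_t ((em t).1 + (c t)%:Z + (c (t + 1))%:Z) =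
         \sum_t (1 + (em t).2 * 2).
    by apply: eq_bigr => t _; have [_ _ ->] := emP t.
  rewrite !big_split /= (shift _ (fun t => (c t)%:Z)) sumr_const card_ord.
  by rewrite -mulr_suml -[p.+3%:Z]natz.
have bnd t : `|(em t).1| <= 1 by have [] := emP t.
(* The terms [1 - s * (em t).1] are nonnegative and their sum is at most 0, so each vanishes. *)
have all1 (s : int) : s * s = 1 -> p.+3%:Z <= s * E -> forall t, (em t).1 = s.
  move=> ss sE.
  have ge0 t : 0 <= 1 - s * (em t).1 by have := bnd t; nia.
  have sum0 : \sum_t (1 - s * (em t).1) = 0.
    apply/eqP; rewrite eq_le sumr_ge0 ?andbT //.
    by rewrite sumrB sumr_const card_ord natz -mulr_sumr -/E subr_le0.
  move=> t; move/psumr_eq0P: sum0 => /(_ (fun t _ => ge0 t)) /(_ t isT).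
  by nia.
have : p.+3%:Z <= E \/ p.+3%:Z <= - E.
  have [k kE] := dvdnP dvdE; case: k kE => [|k] kE; last by nia.
  by exfalso; lia.
case=> hE; [left|right] => t; have [+ _ _] := emP t.
- have -> : (em t).1 = 1 by apply: all1; rewrite ?mul1r.
  by move=> /(canRL (subrK _)) ->; rewrite addrC.
- have -> : (em t).1 = -1 by apply: all1; rewrite ?mulN1r.
  by move=> /(canRL (subrK _)) ->; rewrite addrAC mulrNz addNr add0r.
Qed.

(** * The ladder graph: degrees, copies of the cycle and deletions *)

Section Construction.
Variables (p : nat) (G : finZmodType) (S : {set G}) (L : nat).
Hypothesis oddp : odd p.+3.
Hypothesis S_free : solution_free p.+2 S.

(* Third component None: the Ruzsa-Szemeredi part, made of the cycles
   x, x + s, ..., x + (p+2) s.  Third component Some: the blow-up of a path,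
   whose i-th class is joined to the i-th class of the first part.  The wrap-around
   edges, from class p+2 to class 0, exist only in the first part. *)
Definition vertex := ('I_p.+3 * (G * option 'I_L))%type.

Definition arc (u v : vertex) : bool :=
  (v.1 == u.1 + 1) && match u.2.2, v.2.2 with
  | None, None => if u.1 != ord_max then v.2.1 - u.2.1 \in S
                  else [exists s in S, u.2.1 - v.2.1 == s *+ p.+2]
  | Some _, Some _ => u.1 != ord_max
  | _, _ => false
  end.

Definition rung (u v : vertex) : bool :=
  (u.1 == v.1) && (isSome u.2.2 (+) isSome v.2.2).

Definition ladder_adj : rel vertex := fun u v => [|| arc u v, arc v u | rung u v].

Lemma ladder_sym : symmetric ladder_adj.
Proof.
by move=> u v; rewrite /ladder_adj orbCA /rung eq_sym addbC.
Qed.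

Lemma ladder_irrefl : irreflexive ladder_adj.
Proof.
by move=> u; rewrite /ladder_adj /arc /rung eq_sym ordD1_neq addbb andbF.
Qed.

Definition ladder : sgraph vertex := SGraph ladder_sym ladder_irrefl.

Lemma card_vertex : #|{: vertex}| = (p.+3 * L.+1 * #|G|)%N.
Proof. by rewrite !card_prod card_option !card_ord -mulnA [(#|G| * _)%N]mulnC. Qed.

(** Every vertex is joined to a whole class of the path part: through rungs from the [None] part,
    otherwise to the next class, or to the previous one at the end of the path. *)
Lemma ladder_degree (v : vertex) : (L * #|G| <= degree ladder v)%N.
Proof.
have [j jP] : exists j, forall y, ladder v (j, (y.1, Some y.2)).
  case: v => i [x [l|]]; last first.
    by exists i => y; rewrite /= /ladder_adj /rung /= eqxx !orbT.
  have [->|im] := eqVneq i ord_max.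
    exists (ord_max - 1) => y; rewrite /= /ladder_adj /arc /= subrK eqxx.
    by rewrite andbF [_ - 1 == ord_max]subr_eq eq_sym ordD1_neq.
  by exists (i + 1) => y; rewrite /= /ladder_adj /arc /= eqxx im.
pose F (y : G * 'I_L) : vertex := (j, (y.1, Some y.2)).
have F_inj : injective F by move=> [x l] [x' l'] [-> ->].
have -> : (L * #|G|)%N = #|(F @: [set: G * 'I_L])%SET|.
  by rewrite card_imset // cardsT card_prod card_ord mulnC.
apply: subset_leq_card; apply/fintype.subsetP => _ /imsetP[y _ ->].
by rewrite finset.inE; apply: jP.
Qed.

Definition rs_vertex (x s : G) (i : 'I_p.+3) : vertex := (i, (x + s *+ i, None)).

Lemma rs_vertex_idx {x s i x' s' i'} : rs_vertex x s i = rs_vertex x' s' i' -> i = i'.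
Proof. by case. Qed.

Lemma rs_vertex_val {x s i x' s' i'} :
  rs_vertex x s i = rs_vertex x' s' i' -> x + s *+ i = x' + s' *+ i'.
Proof. by case. Qed.

Lemma rs_vertex_arc (x s : G) (i : 'I_p.+3) : s \in S ->
  arc (rs_vertex x s i) (rs_vertex x s (i + 1)).
Proof.
move=> sS; rewrite /arc eqxx /=; case: ifPn => [im|/negPn/eqP ->].
  rewrite -[(_ %% _)%N]/(nat_of_ord (i + 1)) ordD1_val // mulrS.
  by rewrite opprD addrACA subrr add0r addrK.
apply/existsP; exists s; rewrite sS -[(_ %% _)%N]/(val (ord_max + 1)).
by rewrite ord_max_D1 mulr0n addr0 addrAC subrr add0r /=.
Qed.

(** The wrap-around arc forces [None] at its ends, and arcs never leave a part. The increments along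
    the other arcs sum to [s *+ p.+2], so solution-freeness makes each equal to [s]. *)
Lemma arc_cycle_rs (g : 'I_p.+3 -> vertex) :
    (forall i, (g i).1 = i) -> (forall i, arc (g i) (g (i + 1))) ->
  exists x s, forall i, g i = rs_vertex x s i.
Proof.
move=> g1 g_arc.
have g_const t : isSome (g t).2.2 = isSome (g 0).2.2.
  apply: (@ordD1_const p _ (fun t => isSome (g t).2.2)) => {}t.
  move: (g_arc t); rewrite /arc; case: (g t).2.2; case: (g (t + 1)).2.2 => //.
  - by rewrite andbF.
  - by move=> ?; rewrite andbF.
have g0 : (g 0).2.2 = None.
  move: (g_const ord_max) (g_arc ord_max); rewrite /arc ord_max_D1 !g1 eqxx.
  move=> + /andP[_].
  by case: (g ord_max).2.2; case: (g 0).2.2.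
have gN t : (g t).2.2 = None by move: (g_const t); rewrite g0; case: (g t).2.2.
pose y (n : nat) := (g (inord n)).2.1.
have inordD1 (n : nat) : (n < p.+2)%N -> inord n + 1 = inord n.+1 :> 'I_p.+3.
  by move=> n_lt; apply: ord_inj; rewrite val_ordD1 !inordK ?modn_small // ltnW.
have yS (i : 'I_p.+2) : y i.+1 - y i \in S.
  move: (g_arc (inord i)); rewrite /arc !gN inordD1 // !g1 => /andP[_].
  rewrite ifT //; apply/eqP => /(congr1 val); rewrite /= inordK;
    last exact: ltnW (ltn_ord i : (i.+1 < p.+3)%N).
  by move=> im; move: (ltn_ord i); rewrite im ltnn.
move: (g_arc ord_max); rewrite /arc ord_max_D1 !gN !g1 eqxx.
move=> /andP[_ /existsP[s /andP[sS /eqP ys]]].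
have y_end : \sum_(i < p.+2) (y i.+1 - y i) = s *+ p.+2.
  rewrite -(big_mkord xpredT (fun i => y i.+1 - y i)) telescope_sumr // -ys.
  by congr ((g _).2.1 - (g _).2.1); apply: ord_inj; rewrite inordK.
have step := S_free _ s yS sS y_end.
have yE (n : nat) : (n < p.+3)%N -> y n = y 0 + s *+ n.
  elim: n => [|n IHn] n_lt; first by rewrite mulr0n addr0.
  rewrite mulrSr addrA -IHn 1?ltnW // -(step (Ordinal (n_lt : n < p.+2)%N)).
  by rewrite addrC subrK.
exists (y 0%N), s => i; rewrite /rs_vertex -yE // /y inord_val.
by move: (g1 i) (gN i); case: (g i) => [i' [x' o]] /= -> ->.
Qed.

(** By [odd_walk_monotone] the walk runs through the classes in cyclic order, in one of two
    directions; re-indexed by class, it falls under [arc_cycle_rs]. *)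
Lemma cycle_hom_rs (f : 'I_p.+3 -> vertex) :
    (forall t, ladder (f t) (f (t + 1))) ->
  exists x s, forall t, f t = rs_vertex x s (f t).1.
Proof.
move=> f_adj.
pose i t := (f t).1.
have [] := odd_walk_monotone i (fun t => isSome (f t).2.2) oddp.
- move=> t; move: (f_adj t); rewrite /= /ladder_adj /arc /rung /i.
  case/or3P => /andP[/eqP e]; case: (f t).2.2; case: (f (t + 1)).2.2 => //= *;
    by [left; split=> //; auto | right; auto].
- move=> fwd.
  have iE t : i t = t + i 0.
    have := @ordD1_const p _ (fun t => i t - t) _ t; rewrite subr0 => <-.
      by rewrite addrCA subrr addr0.
    by move=> {}t; rewrite fwd opprD addrACA subrr addr0.
  have [u|u|x [s gE]] := arc_cycle_rs (fun u => f (u - i 0)).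
  + by rewrite -/(i _) iE subrK.
  (* The index advances by 1, which rules out a backward arc or a rung since [p.+3 > 2]. *)
  + rewrite addrAC; move: (f_adj (u - i 0)); rewrite /= /ladder_adj.
    case/or3P => // /andP[]; rewrite -!/(i _) fwd.
      by rewrite eq_sym ordD2_neq.
    by rewrite eq_sym ordD1_neq.
  + by exists x, s => t; rewrite -gE -/(i t) iE addrK.
- move=> bwd.
  have iE t : i t = i 0 - t.
    have := @ordD1_const p _ (fun t => i t + t) _ t; rewrite addr0 => <-.
      by rewrite addrK.
    by move=> {}t; rewrite [i t]bwd -addrA [1 + t]addrC.
  have [u|u|x [s gE]] := arc_cycle_rs (fun u => f (i 0 - u)).
  + by rewrite -/(i _) iE opprB addrCA subrr addr0.
  + set t := i 0 - (u + 1).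
    have -> : i 0 - u = t + 1 by rewrite /t opprD addrA subrK.
    move: (f_adj t); rewrite /= /ladder_adj; case/or3P => // /andP[].
      by rewrite -!/(i _) [i t]bwd eq_sym ordD2_neq.
    by rewrite -!/(i _) [i t]bwd ordD1_neq.
  + by exists x, s => t; rewrite -gE -/(i t) [i t]iE opprB addrCA subrr addr0.
Qed.

(** By [cycle_hom_rs] an embedding is determined by [x], [s] and the sequence of classes visited, so
    only two parameters range over [G]. *)
Lemma card_copies_ladder :
  (#|copies (cycle_graph p.+3) ladder| <= p.+3 ^ p.+3 * #|G| ^ 2)%N.
Proof.
pose copy (f : {ffun 'I_p.+3 -> vertex}) : {set vertex} * {set {set vertex}} :=
  (f @: [set: 'I_p.+3],
   [set f @: (e : {set 'I_p.+3}) | e in edges (cycle_graph p.+3)])%SET.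
pose F (z : G * G * {ffun 'I_p.+3 -> 'I_p.+3}) :=
  copy [ffun t => rs_vertex z.1.1 z.1.2 (z.2 t)].
have -> : (p.+3 ^ p.+3 * #|G| ^ 2)%N = #|[set: G * G * {ffun 'I_p.+3 -> 'I_p.+3}]%SET|.
  by rewrite cardsT !card_prod card_ffun !card_ord mulnC.
apply: leq_trans (leq_imset_card F _); apply: subset_leq_card.
apply/fintype.subsetP => _ /imsetP[f + ->]; rewrite finset.inE => /andP[_ /forallP f_hom].
have [|x [s fE]] := cycle_hom_rs f.
  move=> t; move: (f_hom t) => /forallP /(_ (t + 1)) /implyP; apply.
  by rewrite /= cycle_adjE eqxx.
apply/imsetP; exists (x, s, [ffun t => (f t).1]); rewrite ?finset.in_setT //.
by congr copy; apply/ffunP => t; rewrite !ffunE.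
Qed.

Definition rs_edge (x s : G) (t : 'I_p.+3) : {set vertex} :=
  [set rs_vertex x s t; rs_vertex x s (t + 1)]%SET.

(** This makes the cycles edge-disjoint. An inner edge reveals [s] as a difference; a wrap-around
    edge reveals only [s *+ p.+2], which determines [s] by solution-freeness applied to a constant
    family. *)
Lemma rs_edge_inj (x s x' s' : G) (t t' : 'I_p.+3) : s \in S -> s' \in S ->
  rs_edge x s t = rs_edge x' s' t' -> (x, s) = (x', s').
Proof.
move=> sS s'S eq_edge.
have : rs_vertex x s t \in rs_edge x' s' t' by rewrite -eq_edge finset.set21.
have : rs_vertex x s (t + 1) \in rs_edge x' s' t' by rewrite -eq_edge finset.set22.
rewrite !finset.inE => /orP[] /eqP eq1 /orP[] /eqP eq0.
- have /eqP := etrans (rs_vertex_idx eq1) (esym (rs_vertex_idx eq0)).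
  by rewrite ordD1_neq.
- by have /eqP := rs_vertex_idx eq1; rewrite (rs_vertex_idx eq0) ordD2_neq.
- have tt' := rs_vertex_idx eq0; rewrite -{}tt' in eq0 eq1.
  have {}eq0 := rs_vertex_val eq0; have {}eq1 := rs_vertex_val eq1.
  have [tm|tm] := eqVneq t ord_max.
    move: eq1 eq0; rewrite tm ord_max_D1 !mulr0n !addr0 => -> /addrI ss'.
    congr (_, _); apply: (S_free (fun=> s) s' _ _ _ ord0) => //.
    by rewrite sumr_const card_ord ss'.
  move: eq1; rewrite ordD1_val // !mulrSr !addrA eq0 => /addrI ss'.
  by move: eq0; rewrite ss' => /addIr ->.
- by have /eqP := rs_vertex_idx eq1; rewrite (rs_vertex_idx eq0) ordD1_neq.
Qed.

(** Each of the [#|G| * #|S|] edge-disjoint cycles must lose an edge. *)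
Lemma ladder_deletions (D : {set {set vertex}}) :
  is_free (cycle_graph p.+3) (del_edges ladder D) -> (#|G| * #|S| <= #|D|)%N.
Proof.
move=> D_free.
have /choice[t tP] (z : G * G) : exists t, z.2 \in S -> rs_edge z.1 z.2 t \in D.
  (* Outside [S] the index [0] is a dummy value. *)
  have [zS|] := boolP (z.2 \in S); last by exists 0.
  have [[t tD]|/forallNP no_t] := pselect (exists t, rs_edge z.1 z.2 t \in D).
    by exists t.
  exfalso; pose f := [ffun t => rs_vertex z.1 z.2 t].
  have : embedding (cycle_graph p.+3) (del_edges ladder D) f.
    have f_arc i : del_edges ladder D (f i) (f (i + 1)).
      rewrite /= !ffunE /ladder_adj rs_vertex_arc //=.
      by apply/negP; apply: no_t.
    apply/andP; split; first by apply/injectiveP => i j; rewrite !ffunE => -[].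
    apply/forallP => i; apply/forallP => j; apply/implyP.
    rewrite [cycle_graph _ _ _]cycle_adjE => /orP[] /eqP ->; first exact: f_arc.
    by rewrite adj_sym; apply: f_arc.
  move=> f_emb; suff : copies (cycle_graph p.+3) (del_edges ladder D) != finset.set0.
    by rewrite D_free eqxx.
  by apply/set0Pn; eexists; apply/imsetP; exists f => //; rewrite finset.inE.
have -> : (#|G| * #|S|)%N = #|(finset.setX [set: G] S)%SET| by rewrite cardsX cardsT.
have inj : {in finset.setX [set: G]%SET S &, injective (fun z => rs_edge z.1 z.2 (t z))}.
  move=> [x s] [x' s']; rewrite !finset.inE /= => sS s'S.
  exact: rs_edge_inj.
rewrite -(card_in_imset inj); apply: subset_leq_card.
apply/fintype.subsetP => _ /imsetP[z + ->]; rewrite !finset.inE /= => zS.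
exact: tP.
Qed.

End Construction.

(** * Choice of parameters and the bound on the threshold *)

Lemma removal_delta_superpoly (R : realType) (p : nat) (gamma mu : R) :
    odd p.+3 -> gamma * p.+3%:R < 1 -> 0 < mu ->
  exists2 eps : R, 0 < eps < 1 &
    removal_delta (cycle_graph p.+3) eps gamma < mu * eps `^ mu^-1.
Proof.
move=> oddp gamma_lt mu0.
(* Degrees are at least [L |G|] among [p.+3 * L.+1 * |G|] vertices, and [L / L.+1] tends to 1. *)
have [L L_deg] : exists L : nat, gamma * p.+3%:R * L.+1%:R <= L%:R.
  exists (Num.truncn (1 - gamma * p.+3%:R)^-1).+1.
  have := truncnS_gt (1 - gamma * p.+3%:R)^-1; move: (Num.truncn _).+1 => L.
  rewrite -[X in X < _]div1r ltr_pdivrMr ?subr_gt0 // -[L.+1%:R]natr1.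
  by move: (gamma * _) gamma_lt => c; nra.
have [K KE] : exists K, (p.+3 * L.+1)%N = K by exists (p.+3 * L.+1)%N.
(* [P] exceeds [1 / mu], so [eps^P] is at most [eps^(1 / mu)]. As [eps] will be at least
   [1 / (B D^2)], the exponent [2 P + 1] lets [D^d] exceed [(B D^2)^P] by the factor
   [D / B^P > 1 / mu]. *)
pose P := (Num.truncn mu^-1).+1; pose d := P.*2.+1.
pose A := ((3 * p.+2) ^ d * d.+1)%N; pose B := (2 * K ^ 2 * A)%N.
pose D := (Num.truncn ((B ^ P)%:R / mu)).+1.
have D_large : (B ^ P)%:R < mu * D%:R.
  by rewrite mulrC -ltr_pdivrMr //; apply: truncnS_gt.
have [|||G [S [S_free S0 ub_G lb_G]]] := @dense_solution_free p.+2 D d => //.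
have SG : (#|S| <= #|G|)%N by apply: max_card.
have g0 : (0 < #|G|)%N by apply: leq_trans SG.
have K3 : (p.+3 <= K)%N by rewrite -KE leq_pmulr.
have K0 : (0 < K)%N by apply: leq_trans K3.
(* With [n = K |G|] vertices, [eps n^2] is [|G| |S| / 2], half of what [ladder_deletions]
   demands. *)
pose eps : R := #|S|%:R / (2 * K ^ 2 * #|G|)%:R.
have den0 : 0 < (2 * K ^ 2 * #|G|)%:R :> R.
  by rewrite ltr0n !muln_gt0 g0 K0.
have eps0 : 0 < eps by rewrite divr_gt0 // ltr0n.
have eps1 : eps < 1.
  rewrite ltr_pdivrMr // mul1r ltr_nat (leq_ltn_trans SG) //.
  by rewrite ltn_Pmull // -[X in (X < _)%N]muln1 leq_pmulr // muln_gt0 K0.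
exists eps; first by rewrite eps0.
rewrite ltNge; apply/negP => delta_ge.
have epsD : 1 <= eps * (B * D ^ 2)%:R.
  rewrite mulrAC ler_pdivlMr // mul1r -natrM ler_nat /B.
  apply: leq_trans (_ : 2 * K ^ 2 * (A * D ^ 2 * #|S|) <= _)%N.
    by rewrite leq_mul2l ub_G orbT.
  by rewrite [leqRHS]mulnC !mulnA.
have delta_g : 1 < removal_delta (cycle_graph p.+3) eps gamma * #|G|%:R.
  have epsP : eps ^+ P <= eps `^ mu^-1.
    rewrite -powR_mulrn ?(ltW eps0) //; apply: ger_powR; first by rewrite eps0 ltW.
    by apply/ltW; apply: truncnS_gt.
  have D0 : 0 < (D ^ P.*2)%:R :> R by rewrite ltr0n expn_gt0.
  have epsDP : 1 <= eps ^+ P * ((B ^ P)%:R * (D ^ P.*2)%:R).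
    have := exprn_ege1 P epsD.
    by rewrite exprMn -[in X in X -> _]natrX expnMn natrM -expnM mul2n.
  apply: (lt_le_trans (y := mu * eps ^+ P * (D ^ d)%:R)).
    apply: (le_lt_trans epsDP); rewrite /d expnS natrM.
    have -> : mu * eps ^+ P * (D%:R * (D ^ P.*2)%:R) =
      eps ^+ P * (mu * D%:R * (D ^ P.*2)%:R) by ring.
    by rewrite ltr_pM2l ?exprn_gt0 // ltr_pM2r.
  apply: ler_pM => //; rewrite ?mulr_ge0 ?exprn_ge0 ?(ltW mu0) ?(ltW eps0) //.
    by apply: le_trans delta_ge; rewrite ler_pM2l.
  by rewrite ler_nat.
have [_ /(_ _ (ladder p G S L))] := removal_delta_max (cycle_graph p.+3) eps gamma.
rewrite card_vertex card_ord KE => removal.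
have [v||D' [_ cardD' freeD']] := removal.
- apply: (@le_trans _ _ (L * #|G|)%:R); last by rewrite ler_nat ladder_degree.
  by rewrite -KE !natrM !mulrA ler_pM2r ?ltr0n.
- apply: (@le_lt_trans _ _ (p.+3 ^ p.+3 * #|G| ^ 2)%:R).
    by rewrite ler_nat card_copies_ladder.
  rewrite -natrX.
  (* The factor [delta |G| > 1] turns [|G|^2] into [delta |G|^3]; then [3 <= p.+3 <= K] gives the
     bound [delta (K |G|)^p.+3]. *)
  apply: (@lt_le_trans _ _ (removal_delta (cycle_graph p.+3) eps gamma *
     #|G|%:R * (p.+3 ^ p.+3 * #|G| ^ 2)%:R)).
    by rewrite ltr_pMl // ltr0n muln_gt0 !expn_gt0 g0.
  rewrite -mulrA -natrM; apply: ler_wpM2l.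
    by have [/andP[]] := removal_delta_max (cycle_graph p.+3) eps gamma.
  rewrite ler_nat mulnCA -expnS [leqRHS]expnMn leq_mul //.
    by rewrite leq_exp2r.
  by rewrite leq_pexp2l.
have := ladder_deletions p G S L S_free D' freeD'.
rewrite leqNgt => /negP; apply; rewrite -(ltr_nat R).
apply: (le_lt_trans cardD').
rewrite card_vertex KE /eps.
have [Kn gn] : K%:R != 0 :> R /\ #|G|%:R != 0 :> R.
  by rewrite !pnatr_eq0 -!lt0n g0 K0.
have -> : #|S|%:R / (2 * K ^ 2 * #|G|)%:R * (K * #|G|)%:R ^+ 2 =
    2^-1 * (#|G| * #|S|)%:R :> R.
  by rewrite !natrM; field; rewrite Kn gn.
by rewrite gtr_pMl ?invf_lt1 ?ltr1n // ltr0n muln_gt0 g0.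
Qed.

Theorem theorem4p3 (R : realType) (k : nat) (hk : (0 < k)%N) :
  1 / (2 * k + 1)%:R <= delta_poly_rem R (cycle_graph (2 * k + 1)).
Proof.
(* With the length in the form [p.+3], the index type is a ring modulo the length. *)
have [p kp] : exists p, (2 * k + 1)%N = p.+3 by exists (2 * k.-1)%N; lia.
have oddp : odd p.+3 by rewrite -kp addn1 /= mul2n odd_double.
rewrite kp; apply: lb_le_inf.
  by have [] := @has_inf_poly_rem_set R _ (cycle_graph p.+3); rewrite ?card_ord.
move=> gamma [_ [mu mu0 poly]]; rewrite leNgt; apply/negP.
rewrite ltr_pdivlMr ?ltr0n // => gamma_lt.
have [eps eps01] := removal_delta_superpoly _ _ _ _ oddp gamma_lt mu0.
by rewrite ltNge poly.
Qed.
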